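(* If $G$ is a finite 2-connected graph with maximum degree $\Delta$, then $$M'_D(G) \leq \lceil \sqrt{\Delta} \rceil + 5.$$
   Context: Graphs are finite, simple and undirected. A majority edge coloring is an edge coloring such that for every vertex $u$ and every color $\alpha$, at most half of the edges incident with $u$ have color $\alpha$. It is distinguishing if the only automorphism $\varphi$ of $G$ with $c(\varphi(u)\varphi(v))=c(uv)$ for all edges $uv$ is the identity. $M'_D(G)$ is the least number of colors in an edge coloring of $G$ that is both majority and distinguishing. *)

(* Defs.v *)
From mathcomp Require Import all_boot all_fingroup.

Set Implicit Arguments.
Unset Strict Implicit.
Unset Printing Implicit Defensive.

(* A finite simple graph is a symmetric irreflexive relation [e] on a
   finType; its edges are the two-element sets [set x; y] with [e x y]. *)

Section Graphs.

Variables (T : finType) (e : rel T).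

Definition edges : {set {set T}} := [set [set x; y] | x in T, y in T & e x y].

Definition incident (u : T) : {set {set T}} := [set f in edges | u \in f].

Definition degree (u : T) : nat := #|incident u|.

Definition max_degree : nat := \max_(u : T) degree u.

Definition del_vertices (X : {set T}) : rel T :=
  [rel x y | [&& x \notin X, y \notin X & e x y]].

(* More than k vertices, and no set of fewer than k vertices separates the
   graph (X = set0 gives connectedness as soon as 0 < k). *)
Definition k_connected (k : nat) : Prop :=
  k < #|T| /\
  forall X : {set T}, #|X| < k ->
    forall x y : T, x \notin X -> y \notin X -> connect (del_vertices X) x y.

Definition automorphism (phi : {perm T}) : Prop :=
  forall x y : T, e (phi x) (phi y) = e x y.

Section Colorings.

(* An edge coloring is given by a function on all vertex sets, of which only
   the values on [edges] are ever used. *)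
Variable c : {set T} -> nat.

Definition edge_coloring (k : nat) : Prop := forall f, f \in edges -> c f < k.

Definition majority : Prop :=
  forall (u : T) (a : nat),
    2 * #|[set f in incident u | c f == a]| <= #|incident u|.

Definition preserves_coloring (phi : {perm T}) : Prop :=
  forall u v : T, e u v -> c [set phi u; phi v] = c [set u; v].

Definition distinguishing : Prop :=
  forall phi : {perm T},
    automorphism phi -> preserves_coloring phi -> phi = 1%g.

End Colorings.

Definition majority_distinguishing_colorable (k : nat) : Prop :=
  exists c : {set T} -> nat,
    [/\ edge_coloring c k, majority c & distinguishing c].

(* [m] is the value of M'_D(G). This is a relation because a graph with a
   vertex of degree 1, for instance, has no majority edge coloring at all. *)
Definition is_majority_distinguishing_index (m : nat) : Prop :=
  majority_distinguishing_colorable m /\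
  forall k : nat, majority_distinguishing_colorable k -> m <= k.

End Graphs.

(* Main.v *)
(** Let [k] be the ceiling of the square root of Delta.  By 2-connectivity the
vertices can be ordered from [s] to an adjacent vertex [t] so that every vertex
but [s] has an earlier neighbor and every vertex but [t] a later one.  Colors
[k + 3] and [k + 4] are used once each, on [st] and on another edge [su], which
makes every color-preserving automorphism fix [s] and [t].  The other edges
are colored greedily with [k + 3] colors, in lexicographic order of their
(earlier, later) ends.  When [vw] is colored, a color is saturated at an end if
one more use breaks the majority condition; at most one color is saturated at
[w], and at most one (two if [w] is the latest neighbor of [v]) at [v].  If [w]
is not the latest neighbor of [v], avoid the at most [k] colors already used
[k - 1] times on such forward edges of [v].  If it is, all the edges of [v] are
now colored, and avoid the colors that would give [v] the same color sum as an
earlier vertex with the same parent (earliest neighbor) joined to it by the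
same color; there are at most [k - 1] such vertices.  By induction on the
parent, an automorphism preserving the coloring fixes every vertex. *)

Require Import Defs.
From HB Require Import structures.
From mathcomp Require Import all_boot all_order all_algebra all_fingroup.
From mathcomp Require Import reals.
From mathcomp Require Import boolp zify.

Set Implicit Arguments.
Unset Strict Implicit.
Unset Printing Implicit Defensive.

Import Order.TTheory GRing.Theory Num.Theory.

(** An st-numbering of the subgraph induced by [S], gaps allowed; [S] is a parameter so that it can
    grow ear by ear. *)
Definition st_order (T : finType) (e : rel T) (s t : T) (S : {set T})
    (f : T -> nat) : Prop :=
  [/\ {in S &, injective f}, s \in S, t \in S,
      forall x, x \in S -> x != s -> exists y, [/\ y \in S, e x y & f y < f x]
    & forall x, x \in S -> x != t -> exists y, [/\ y \in S, e x y & f x < f y]].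

(** * Orders from s to t *)

(** This renumbering frees the [k] values from [m.+1] on for the inner vertices of an ear. *)
Lemma shift_ltn m k i j : i < j ->
  (if i <= m then i else i + k) < (if j <= m then j else j + k).
Proof. by case: (leqP i m); case: (leqP j m); lia. Qed.

Lemma shift_gap m k i j : i < k -> m.+1 + i != (if j <= m then j else j + k).
Proof. by case: (leqP j m); lia. Qed.

Section Order.

Variables (T : finType) (e : rel T).
Hypotheses (e_sym : symmetric e) (e_irr : irreflexive e).

(** The inner vertices [P] go just above [a], in path order, and larger values move up. Each then
    lies between its two path neighbors; for the last one this uses [f a < f b]. *)
Lemma st_order_ear (s t : T) (S : {set T}) (f : T -> nat) a b (P : seq T) :
    st_order e s t S f -> a \in S -> b \in S -> f a < f b ->
    uniq P -> all (fun z => z \notin S) P -> path e a (rcons P b) ->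
  exists f', st_order e s t (S :|: [set z in P]) f'.
Proof.
case=> f_inj sS tS lowS upS aS bS ltab uP /allP PS pathP_.
exists (fun z => if z \in P then (f a).+1 + index z P
                 else if f z <= f a then f z else f z + size P).
have SP z : z \in S -> (z \in P) = false.
  by move=> zS; apply/negP => /PS; rewrite zS.
have memU z : z \in S :|: [set z in P] = (z \in S) || (z \in P).
  by rewrite in_setU inE.
have ltP z : z \in P -> index z P < size P by rewrite index_mem.
have edge := pathP a pathP_; rewrite size_rcons in edge.
split; rewrite ?memU ?sS ?tS //.
- move=> x y; rewrite !memU.
  case xP: (x \in P); case yP: (y \in P); rewrite ?orbT ?orbF.
  + move=> _ _ /eqP; rewrite eqn_add2l => /eqP eqi.
    by rewrite -(nth_index x xP) eqi nth_index.
  + by move=> _ _ /eqP; rewrite (negPf (shift_gap _ _ (ltP _ xP))).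
  + by move=> _ _ /esym/eqP; rewrite (negPf (shift_gap _ _ (ltP _ yP))).
  + move=> xS yS eqf; apply: f_inj => //; move/eqP: eqf.
    have [/(shift_ltn (f a) (size P))|/(shift_ltn (f a) (size P))|//] :=
      ltngtP (f x) (f y); by rewrite ltn_neqAle => /andP[]; rewrite 1?eq_sym => /negPf->.
- move=> x; rewrite memU; case xP: (x \in P); last first.
    rewrite orbF => xS xs; have [y [yS exy ltyx]] := lowS _ xS xs.
    by exists y; rewrite memU yS exy SP //; split=> //; apply: shift_ltn.
  move=> _ _; have lti := ltP _ xP.
  have := edge (index x P) (leqW lti).
  rewrite nth_rcons lti nth_index //.
  case Ei: (index x P) lti => [|i] lti /=.
    move=> eax; exists a; rewrite memU aS e_sym eax SP //; split=> //.
    by rewrite leqnn addn0.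
  rewrite nth_rcons (ltnW lti) => eyx.
  have yP : nth a P i \in P by rewrite mem_nth // ltnW.
  exists (nth a P i); rewrite memU yP orbT e_sym eyx; split=> //.
  by rewrite index_uniq ?(ltnW lti) // ltn_add2l.
- move=> x; rewrite memU; case xP: (x \in P); last first.
    rewrite orbF => xS xt; have [y [yS exy ltxy]] := upS _ xS xt.
    by exists y; rewrite memU yS exy SP //; split=> //; apply: shift_ltn.
  move=> _ _; have lti := ltP _ xP.
  have := edge (index x P).+1; rewrite ltnS => /(_ lti) /=.
  rewrite !nth_rcons lti nth_index //.
  have [ltj|] := ltnP (index x P).+1 (size P) => exy.
    have yP : nth a P (index x P).+1 \in P by rewrite mem_nth.
    exists (nth a P (index x P).+1); rewrite memU yP orbT exy; split=> //.
    by rewrite index_uniq // ltn_add2l.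
  have -> : (index x P).+1 == size P by rewrite eqn_leq lti.
  move=> exb; exists b; rewrite memU bS exb SP //; split=> //.
  by rewrite [f b <= f a]leqNgt ltab -addnS leq_add.
Qed.

Hypothesis e_2conn : k_connected e 2.

(** Without [z] the graph is still connected, so a path from [x] to a third vertex starts with the
    desired edge. *)
Lemma neighbor_avoiding x z : x != z -> exists2 y, e x y & y != z.
Proof.
move=> xz; case: e_2conn => ltT conn2.
have [y] : exists y, y \notin [set x; z].
  apply/existsP; rewrite -negb_forall; apply/negP => /forallP sub.
  have : #|T| <= #|[set x; z]|.
    by apply: subset_leq_card; apply/subsetP => y _; apply: sub.
  by rewrite cards2; case: (x != z); lia.
rewrite !inE negb_or => /andP[yx yz].
have : connect (del_vertices e [set z]) x y.
  by apply: conn2; rewrite ?cards1 ?inE.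
case/connectP => -[|w p] /=; first by move=> _ eyx; rewrite eyx eqxx in yx.
by case/andP => /and3P[_ wz exw] _ _; exists w; rewrite // -in_set1.
Qed.

(** Some edge [a x] leaves [S]. Without [a] there is still a path from [x] to another vertex of [S];
    it is cut at its first vertex [b] in [S]. *)
Lemma ear_exists (S : {set T}) s t x0 :
    s \in S -> t \in S -> s != t -> x0 \notin S ->
  exists a b P, [/\ a \in S, b \in S, a != b & P != [::]] /\
    [/\ uniq P, all (fun z => z \notin S) P & path e a (rcons P b)].
Proof.
move=> sS tS st x0S; case: e_2conn => _ conn2.
have [a [x [aS xS eax]]] : exists a x, [/\ a \in S, x \notin S & e a x].
  have : connect (del_vertices e set0) s x0.
    by apply: conn2; rewrite ?cards0 ?inE.
  clear st; case/connectP => p; elim: p s sS => [|y p IHp] s1 s1S /=.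
    by move=> _ x0s; rewrite x0s s1S in x0S.
  case/andP => /and3P[_ _ esy] py lastx.
  by case yS: (y \in S); [apply: (IHp y) | exists s1, y; rewrite yS].
have [b0 b0S b0a] : exists2 b0, b0 \in S & b0 != a.
  by have [<-|sa] := eqVneq s a; [exists t; rewrite 1?eq_sym | exists s].
have xa : x != a by apply: contraNneq xS => ->.
have : connect (del_vertices e [set a]) x b0.
  by apply: conn2; rewrite ?cards1 ?inE.
case/connectP => p0 /shortenP[p pathp up _] lastp.
have : has (mem S) p.
  case: p lastp {pathp up} => [|y p] lastp; first by rewrite lastp /= (negPf xS) in b0S.
  by apply/hasP; exists b0 => //; rewrite lastp; apply: (mem_last y p).
move=> hasS; case: (split_find hasS) pathp up => b q1 q2 bS hasp pathp up.
exists a, b, (x :: q1); move: pathp; rewrite cat_path rcons_path.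
case/andP => /andP[pathp eb] _; move: eb => /and3P[_ ba elb].
have pe : path e x q1 by apply: sub_path pathp => y z /and3P[].
split; first by split=> //; rewrite eq_sym; rewrite inE in ba.
split.
- by move: up; rewrite -cat_cons -rcons_cons cat_uniq rcons_uniq => /andP[/andP[]].
- by rewrite /= xS; rewrite -all_predC in hasp.
- by rewrite /= rcons_path eax pe.
Qed.

Lemma st_order_exists s t : e s t -> exists f, st_order e s t setT f.
Proof.
move=> est; have st : s != t by apply: contraTneq est => ->; rewrite e_irr.
have : exists S f, st_order e s t S f.
  exists [set s; t], (fun z => (z == t) : nat); split; rewrite ?set21 ?set22 //.
  - by move=> x y /set2P[]-> /set2P[]-> //=; rewrite eqxx (negPf st).
  - move=> x /set2P[]->; rewrite ?eqxx // => _.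
    by exists s; rewrite /= set21 e_sym est ?eqxx (negPf st).
  - move=> x /set2P[]->; rewrite ?eqxx // => _.
    by exists t; rewrite /= set22 est ?eqxx (negPf st).
case=> S; move: {2}_.+1 (ltnSn #|~: S|) => n.
elim: n S => // n IHn S ltn [f fS].
have [ST|] := eqVneq S setT; first by exists f; rewrite -ST.
rewrite -subTset => /subsetPn[x0 _ x0S].
have [_ sS tS _ _] := fS.
have [a [b [P [[aS bS ab P0] [uP PS pathP_]]]]] := ear_exists sS tS st x0S.
have [f' f'S] : exists f', st_order e s t (S :|: [set z in P]) f'.
  have [ltab|ltba|eqab] := ltngtP (f a) (f b).
  - exact: st_order_ear fS aS bS ltab uP PS pathP_.
  (* Ears are inserted upwards from their lower end, so this one is traversed backwards. *)
  - have := st_order_ear fS bS aS ltba (P := rev P).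
    rewrite rev_uniq all_rev uP PS.
    have -> : S :|: [set z in rev P] = S :|: [set z in P].
      by congr (_ :|: _); apply/setP=> z; rewrite !inE mem_rev.
    apply=> //; have := rev_path e a (rcons P b).
    rewrite last_rcons belast_rcons rev_cons => ->.
    by rewrite (eq_path (e' := e)).
  - by have [f_inj _ _ _ _] := fS; rewrite (f_inj _ _ aS bS eqab) eqxx in ab.
apply: (IHn (S :|: [set z in P])); last by exists f'.
apply: leq_trans (_ : #|~: S| <= n); last by rewrite -ltnS.
apply: proper_card; rewrite properE setCS subsetUl /=.
case: P P0 PS {uP pathP_ f'S} => // z P _ /= /andP[zS _].
apply/subsetPn; exists z; first by rewrite inE.
by rewrite !inE eqxx orbT.
Qed.

End Order.

(** * The greedy coloring *)

Lemma set2_injr (T : finType) (x y z : T) : [set x; y] = [set x; z] -> y = z.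
Proof.
move=> eqs; have := set22 x y; rewrite eqs => /set2P[yx|//].
by have := set22 x z; rewrite -eqs => /set2P[->|->].
Qed.

Lemma set2_eq (T : finType) (x y v w : T) :
  [set x; y] = [set v; w] -> x = v /\ y = w \/ x = w /\ y = v.
Proof.
move=> eqs; have := set21 x y; rewrite eqs => /set2P[] xE; subst x.
  by left; split=> //; apply: set2_injr eqs.
by right; split=> //; apply: (@set2_injr _ w); rewrite eqs setUC.
Qed.

(** * Counting colors at a vertex *)

Section ColorCount.

Variables (T : finType) (c : {set T} -> nat) (Y : {set T}) (x : T).

Definition color_count (a : nat) : nat := #|[set y in Y | c [set x; y] == a]|.

Lemma sum_color_count K (A : {set 'I_K}) :
  \sum_(a in A) color_count a <= #|[set y in Y | c [set x; y] < K]|.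
Proof.
set Z := [set y in Y | _].
have -> : \sum_(a in A) color_count a
    = \sum_(a in A) \sum_(y in Z) (c [set x; y] == a :> nat).
  apply: eq_bigr => a _; rewrite /color_count -sum1_card.
  rewrite (big_mkcond (fun y => y \in [set _ in _ | _])) [RHS]big_mkcond /=.
  apply: eq_bigr => y _; rewrite !inE.
  by case: (y \in Y) => //=; case: eqP => [->|_]; rewrite ?ltn_ord //; case: ifP.
rewrite exchange_big /= -sum1_card leq_sum // => y; rewrite inE => /andP[_ ltc].
have [cA|cA] := boolP (Ordinal ltc \in A).
  rewrite (bigD1 _ cA) /= eqxx big1 // => a /andP[_].
  by rewrite -val_eqE /= eq_sym => /negPf->.
rewrite big1 // => a aA; case: eqP => // ca; case/negP: cA.
by rewrite (_ : Ordinal _ = a) //; apply: val_inj.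
Qed.

(** Each frequent color takes up [m] vertices of [N], none of them in [H], where only colors outside
    the palette ['I_K] can be counted. *)
Lemma card_frequent_colors K m (N H : {set T}) :
    Y \subset N -> H \subset N ->
    (forall y, y \in H -> y \in Y -> K <= c [set x; y]) ->
  #|[set a : 'I_K | m <= color_count a]| * m + #|H| <= #|N|.
Proof.
move=> /subsetP YN /subsetP HN HY; set A := [set a | _].
have leA : #|A| * m <= #|[set y in Y | c [set x; y] < K]|.
  apply: leq_trans (sum_color_count A); rewrite -sum_nat_const.
  by apply: leq_sum => a; rewrite inE.
apply: leq_trans (leq_add leA (leqnn #|H|)) _; rewrite addnC -(cardsID H N).
rewrite leq_add ?subset_leq_card //; apply/subsetP => y; rewrite !inE.
  by move=> yH; rewrite yH HN.
case/andP=> yY ltc; rewrite YN // andbT; apply: contraTN ltc => yH.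
by rewrite -leqNgt HY.
Qed.

End ColorCount.

(** The condition on [a] says that it is used at least [#|Y|./2] times. One vertex set aside in [H]
    leaves room for at most two such colors, two vertices for at most one. *)
Lemma card_saturated_colors (T : finType) (c : {set T} -> nat) (Y : {set T})
    (x : T) K (H : {set T}) :
    1 < #|Y| -> 0 < #|H| <= 2 ->
    (forall y, y \in H -> y \in Y /\ K <= c [set x; y]) ->
  #|[set a : 'I_K | #|Y| < 2 * (color_count c Y x a).+1]| + #|H| <= 3.
Proof.
move=> Y2 H12 HY.
have HsY : H \subset Y by apply/subsetP => y /HY[].
have HcY y : y \in H -> y \in Y -> K <= c [set x; y] by case/HY.
have := card_frequent_colors #|Y|./2 (subxx Y) HsY HcY.
set A := [set a | _]; set B := [set a | _].
have -> : A = B.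
  by apply/setP => a; rewrite !inE; apply/idP/idP; lia.
have := odd_double_half #|Y|; move: #|B| #|H| H12 #|Y|./2 #|Y| Y2 => b h H12 y2 y.
by case: (odd y) => /=; nia.
Qed.

Definition recolor (T : finType) (c : {set T} -> nat) g a : {set T} -> nat :=
  fun g' => if g' == g then a else c g'.

Lemma color_count_recolor (T : finType) (c : {set T} -> nat) (Y : {set T})
    (x y : T) a b :
  color_count (recolor c [set x; y] b) Y x a <=
  color_count c Y x a + ((y \in Y) && (a == b)).
Proof.
have [/andP[yY /eqP <-]|nYab] := boolP (_ && _).
  rewrite addnC -[nat_of_bool _](cards1 y) /color_count.
  apply: leq_trans (leq_card_setU _ _); apply: subset_leq_card.
  apply/subsetP => z; rewrite !inE /recolor; case/andP=> -> /=.
  have [/set2_injr->|_ ->] := eqVneq [set x; z] [set x; y].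
    by move=> _; rewrite eqxx.
  by rewrite orbT.
rewrite addn0; apply: subset_leq_card; apply/subsetP => z.
rewrite !inE /recolor; case/andP=> zY; rewrite zY /=.
have [/set2_injr zy|//] := eqVneq [set x; z] [set x; y].
by rewrite -zy zY /= eq_sym in nYab; rewrite (negPf nYab).
Qed.

Lemma recolor_notin (T : finType) (c : {set T} -> nat) (g : {set T}) a x y :
  x \notin g -> recolor c g a [set x; y] = c [set x; y].
Proof.
by rewrite /recolor; case: eqP => // <-; rewrite set21.
Qed.

Lemma leq_count_step (p q d : nat) (b : bool) :
  p <= q + b -> 2 * q <= d -> (b -> 2 * q.+1 <= d) -> 2 * p <= d.
Proof. by case: b => /= le1 le2 => [/(_ isT)|_]; lia. Qed.

Lemma ltn_count_step (p q d : nat) (b : bool) :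
  p <= q + b -> q < d -> (b -> q.+1 < d) -> p < d.
Proof. by case: b => /= le1 le2 => [/(_ isT)|_]; lia. Qed.

Section GreedyColoring.

Variables (T : finType) (e : rel T) (s t u : T) (f : T -> nat) (M k : nat).
Variables lat par : T -> T.

Definition nbr x : {set T} := [set y | e x y].

(** [lat x] is left out because the edge to it is chosen for the color sum, not for the bound on
    repeated colors. *)
Definition forward x : {set T} := [set y in nbr x | (f x < f y) && (y != lat x)].

Definition color_sum (c : {set T} -> nat) x : nat :=
  \sum_(y in nbr x) c [set x; y].

Definition special (g : {set T}) : bool := (g == [set s; t]) || (g == [set s; u]).

(** As [f] stays below [M], this encodes the lexicographic order of the pairs [(f x, f y)]. *)
Definition key x y : nat := f x * M + f y.

(* Edges of key below [n] are colored, as are the special edges from the start;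
   color [k + 5] stands for uncolored. *)
Record greedy_inv (n : nat) (c : {set T} -> nat) : Prop := GreedyInv {
  inv_st : c [set s; t] = k + 3;
  inv_su : c [set s; u] = k + 4;
  inv_done : forall x y, e x y -> f x < f y -> ~~ special [set x; y] ->
    key x y < n -> c [set x; y] < k + 3;
  inv_todo : forall x y, e x y -> f x < f y -> ~~ special [set x; y] ->
    n <= key x y -> c [set x; y] = k + 5;
  inv_majority : forall x a, a < k + 5 ->
    2 * color_count c (nbr x) x a <= #|nbr x|;
  inv_forward : forall x a, a < k + 5 -> color_count c (forward x) x a < k;
  inv_sum : forall x y, f y < f x -> y != s -> x != t -> key x (lat x) < n ->
    par x = par y -> c [set x; par x] = c [set y; par y] ->
    color_sum c x <> color_sum c y }.

Hypotheses (e_sym : symmetric e) (e_irr : irreflexive e).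
Hypotheses (f_inj : injective f) (f_lt : forall x, f x < M).
Hypotheses (f_low : forall x, x != s -> exists2 y, e x y & f y < f x).
Hypotheses (f_up : forall x, x != t -> exists2 y, e x y & f x < f y).
Hypotheses (est : e s t) (esu : e s u) (ut : u != t).
Hypotheses (k_gt1 : 1 < k) (nbr_le : forall x, #|nbr x| <= k * k).
Hypothesis nbr_gt1 : forall x, 1 < #|nbr x|.
Hypotheses (lat_nbr : forall x, e x (lat x))
  (lat_max : forall x y, e x y -> f y <= f (lat x)).
Hypotheses (par_nbr : forall x, e x (par x))
  (par_min : forall x y, e x y -> f (par x) <= f y).

Lemma st_neq : s != t.
Proof. by apply: contraTneq est => ->; rewrite e_irr. Qed.

Lemma f_lt_lat x : x != t -> f x < f (lat x).
Proof. by case/f_up => y exy ltxy; apply: leq_trans ltxy (lat_max exy). Qed.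

Lemma f_par_lt x : x != s -> f (par x) < f x.
Proof. by case/f_low => y exy; apply: leq_ltn_trans (par_min exy). Qed.

Lemma f_s_lt x : x != s -> f s < f x.
Proof.
move: {2}_.+1 (ltnSn (f x)) => n; elim: n x => // n IHn x ltn xs.
have [y _ ltyx] := f_low xs; have [<-//|ys] := eqVneq y s.
by apply: (ltn_trans _ ltyx); apply: IHn => //; apply: leq_trans ltyx _.
Qed.

Lemma f_t_gt x : x != t -> f x < f t.
Proof.
move: {2}_.+1 (ltnSn (M - f x)) => n; elim: n x => // n IHn x ltn xt.
have [y _ ltxy] := f_up xt; have [<-//|yt] := eqVneq y t.
apply: (ltn_trans ltxy); apply: IHn => //.
by have := f_lt x; have := f_lt y; lia.
Qed.

(** [t] is the last vertex and a neighbor of [s]. So the last edge at [s] is special, and no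
    color-sum choice is made there. *)
Lemma lat_s : lat s = t.
Proof.
apply/eqP/negPn/negP => /f_t_gt; rewrite ltnNge lat_max //.
Qed.

Lemma key_ltl x y x' y' : f x < f x' -> key x y < key x' y'.
Proof. by move=> ltx; rewrite /key; have := f_lt y; nia. Qed.

Lemma key_ltr x y y' : (key x y < key x y') = (f y < f y').
Proof. by rewrite /key ltn_add2l. Qed.

Lemma key_ler x y y' : (key x y <= key x y') = (f y <= f y').
Proof. by rewrite /key leq_add2l. Qed.

Lemma key_inj x y x' y' : key x y = key x' y' -> x = x' /\ y = y'.
Proof.
move=> eqk; case: (ltngtP (f x) (f x')) => [lt|lt|/f_inj xx'].
- by have := key_ltl y y' lt; rewrite eqk ltnn.
- by have := key_ltl y' y lt; rewrite eqk ltnn.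
by split=> //; subst x'; move/eqP: eqk; rewrite /key eqn_add2l => /eqP/f_inj.
Qed.

Lemma special_memb g : special g -> s \in g.
Proof. by case/orP => /eqP->; rewrite set21. Qed.

(** Only the special edges have colors below [k + 5], and these differ. So each count is at most 1,
    within both bounds since degrees and [k] exceed 1. *)
Lemma greedy_inv0 :
  greedy_inv 0 (fun g => if g == [set s; t] then k + 3
                         else if g == [set s; u] then k + 4 else k + 5).
Proof.
set c := fun g => _.
have su_st : ([set s; u] == [set s; t]) = false.
  by apply/eqP => /set2_injr /eqP; rewrite (negPf ut).
have count1 Y x a : a < k + 5 -> color_count c Y x a <= 1.
  move=> lta; apply/card_le1_eqP => y z; rewrite !inE /c.
  case/andP=> _ /eqP yE /andP[_ /eqP]; move: yE.
  case: eqP => [ey|_]; first by move=> <-; case: eqP => [ez _|_];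
    [apply: (@set2_injr _ x); rewrite ez ey | case: eqP; lia].
  case: eqP => [ey|_]; last by lia.
  move=> <-; case: eqP => [_|_]; first lia.
  by case: eqP => [ez _|_]; [apply: (@set2_injr _ x); rewrite ez ey | lia].
split=> //.
- by rewrite /c eqxx.
- by rewrite /c su_st eqxx.
- by move=> x y _ _; rewrite /special negb_or /c => /andP[/negPf-> /negPf->].
- by move=> x a lta; have := count1 (nbr x) x a lta; have := nbr_gt1 x; lia.
- by move=> x a lta; apply: leq_ltn_trans (count1 _ _ _ lta) k_gt1.
Qed.

(** * Coloring one more edge *)

Section Step.

Variables (n : nat) (c : {set T} -> nat).
Hypothesis cI : greedy_inv n c.

(** Uncolored and special edges alike lie outside the greedy palette: they take up room at a vertex
    without adding to any greedy color. *)
Lemma color_ge x y : e x y -> f x < f y -> n <= key x y -> k + 3 <= c [set x; y].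
Proof.
move=> exy ltxy len; case sp: (special [set x; y]).
  by case/orP: sp => /eqP->; rewrite ?(inv_st cI) ?(inv_su cI); lia.
by rewrite (inv_todo cI) ?sp //; lia.
Qed.

Lemma color_lt x y : e x y -> f x < f y -> key x y < n -> c [set x; y] < k + 5.
Proof.
move=> exy ltxy len; case sp: (special [set x; y]).
  by case/orP: sp => /eqP->; rewrite ?(inv_st cI) ?(inv_su cI); lia.
by apply: leq_trans (inv_done cI exy ltxy _ len) _; rewrite ?sp //; lia.
Qed.

Variables v w : T.
Hypotheses (evw : e v w) (ltvw : f v < f w) (nsp : ~~ special [set v; w])
  (keyn : key v w = n).

Let vt : v != t.
Proof.
by apply: contraTneq ltvw => ->; rewrite -leqNgt; have [->|/f_t_gt/ltnW] := eqVneq w t.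
Qed.

(** The key of [v] and [lat v] is at least [n], and all keys starting at [w] exceed [n]. Hence the
    color sum of a completed vertex no longer changes. *)
Lemma completed_edge_neq x z : e x z -> key x (lat x) < n -> [set x; z] != [set v; w].
Proof.
move=> exz ltn; apply/eqP => /set2_eq[[xv zw]|[xw zv]]; subst x z.
  by move: ltn; rewrite -keyn key_ltr ltnNge lat_max.
by move: ltn; rewrite -keyn ltnNge ltnW // key_ltl.
Qed.

Lemma greedy_step a : a < k + 3 ->
    #|nbr v| >= 2 * (color_count c (nbr v) v a).+1 ->
    #|nbr w| >= 2 * (color_count c (nbr w) w a).+1 ->
    (w != lat v -> (color_count c (forward v) v a).+1 < k) ->
    (w = lat v -> forall y, f y < f v -> y != s ->
      par v = par y -> c [set v; par v] = c [set y; par y] ->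
      a + \sum_(z in nbr v | z != w) c [set v; z] <> color_sum c y) ->
  greedy_inv n.+1 (recolor c [set v; w] a).
Proof.
move=> lta majv majw forwardv sumv; set c' := recolor _ _ _.
have c'E g : g != [set v; w] -> c' g = c g by rewrite /c' /recolor => /negPf->.
have c'vw : c' [set v; w] = a by rewrite /c' /recolor eqxx.
have setE x y : f x < f y -> [set x; y] = [set v; w] -> x = v /\ y = w.
  move=> ltxy /set2_eq[//|[xw yv]].
  by rewrite xw yv ltnNge (ltnW ltvw) in ltxy.
move: (nsp); rewrite negb_or => /andP[nst nsu].
split.
- by rewrite c'E 1?eq_sym // (inv_st cI).
- by rewrite c'E 1?eq_sym // (inv_su cI).
- move=> x y exy ltxy nspxy; rewrite ltnS leq_eqVlt.
  have [-> _|neq] := eqVneq [set x; y] [set v; w]; first by rewrite c'vw.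
  rewrite c'E // => /orP[/eqP kn|]; last exact: (inv_done cI).
  by case/eqP: neq; rewrite -keyn in kn; have [-> ->] := key_inj kn.
- move=> x y exy ltxy nspxy ltn; rewrite c'E; first exact: (inv_todo cI) (ltnW ltn).
  by apply: contraTneq ltn => /(setE _ _ ltxy)[-> ->]; rewrite keyn ltnn.
- move=> x b ltb; have maj := inv_majority cI x ltb.
  have [xv|xv] := eqVneq x v.
    subst x; apply: leq_count_step (color_count_recolor c _ v w b a) maj _.
    by case/andP=> _ /eqP->.
  have [xw|xw] := eqVneq x w.
    subst x; rewrite /c' setUC.
    apply: leq_count_step (color_count_recolor c _ w v b a) maj _.
    by case/andP=> _ /eqP->.
  have -> : color_count c' (nbr x) x b = color_count c (nbr x) x b.
    congr #|pred_of_set _|; apply/setP => y; rewrite [LHS]inE [RHS]inE.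
    by rewrite /c' recolor_notin // !inE negb_or xv.
  exact: maj.
- move=> x b ltb; have ltk := inv_forward cI x ltb.
  have [xv|xv] := eqVneq x v.
    subst x; apply: ltn_count_step (color_count_recolor c _ v w b a) ltk _.
    by case/andP; rewrite !inE => /andP[_ /andP[_ /forwardv lta']] /eqP->.
  have -> : color_count c' (forward x) x b = color_count c (forward x) x b.
    congr #|pred_of_set _|; apply/setP => y; rewrite [LHS]inE [RHS]inE.
    case yE: (y \in _) => //=; rewrite c'E //; apply/eqP.
    move: yE; rewrite !inE => /andP[_ /andP[ltxy _]] /(setE _ _ ltxy)[xv' _].
    by rewrite xv' eqxx in xv.
  exact: ltk.
- move=> x y ltyx ys xt; rewrite ltnS leq_eqVlt => keyx parxy.
  have yt : y != t by apply: contraTneq ltyx => ->; rewrite -leqNgt ltnW ?f_t_gt.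
  (* The earlier vertex [y] was completed before, so only the sum at [x] can be new. *)
  have keyy : key y (lat y) < n.
    apply: leq_trans (key_ltl _ (lat x) ltyx) _.
    by case/orP: keyx => [/eqP->|/ltnW].
  have colorE z z' : e z z' -> key z (lat z) < n -> c' [set z; z'] = c [set z; z'].
    by move=> ezz' ltz; rewrite c'E // completed_edge_neq.
  have sumE z : key z (lat z) < n -> color_sum c' z = color_sum c z.
    by move=> ltz; apply: eq_bigr => z'; rewrite inE => ezz'; rewrite colorE.
  rewrite (sumE y) // (colorE y) //.
  (* Either [x] was completed before, or the edge just colored is its last one, so that [x = v] and
     [w = lat v]. *)
  case/orP: keyx => [/eqP kn|ltx]; last first.
    by rewrite sumE // (colorE x) //; apply: (inv_sum cI).
  rewrite -keyn in kn; have [xv latw] := key_inj kn; subst x.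
  have vs : v != s.
    by apply: contraTneq ltyx => ->; rewrite -leqNgt ltnW // f_s_lt.
  rewrite c'E; last first.
    apply/eqP => /set2_injr parw; have := f_par_lt vs.
    by rewrite parw ltnNge (ltnW ltvw).
  move=> pare; have := sumv (esym latw) y ltyx ys parxy pare.
  rewrite [color_sum c' v](bigD1 w) ?inE //= c'vw.
  congr (_ + _ <> _ : Prop); apply: eq_bigr => z /andP[_ zw].
  by rewrite c'E //; apply: contra_neq zw => /set2_injr.
Qed.


Let f_vw_le z : f z <= f v -> z != w.
Proof. by move=> le; apply: contraTneq ltvw => <-; rewrite -leqNgt. Qed.

Let saturated x := [set a : 'I_(k + 3) | #|nbr x| < 2 * (color_count c (nbr x) x a).+1].

(* Another edge at [w] is uncolored or special: its last forward edge, or [st]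
   when [w = t]. *)
Lemma card_saturated_w : #|saturated w| <= 1.
Proof.
have evw' : e w v by rewrite e_sym.
have cwv : k + 3 <= c [set w; v] by rewrite setUC color_ge ?keyn.
suff [z [vz ewz cwz]] : exists z, [/\ v != z, e w z & k + 3 <= c [set w; z]].
  have := @card_saturated_colors _ c (nbr w) w (k + 3) [set v; z] (nbr_gt1 w).
  rewrite cards2 vz -/(saturated w) addn2 !ltnS; apply=> // y.
  by case/set2P=> ->; rewrite inE.
have [wt|wt] := eqVneq w t.
  exists s; subst w; rewrite e_sym est setUC (inv_st cI) leq_add //; split=> //.
  by apply: contraNneq nsp => ->; rewrite /special eqxx.
have ltwl := f_lt_lat wt.
exists (lat w); rewrite lat_nbr color_ge ?lat_nbr //; last first.
  by rewrite -keyn ltnW // key_ltl.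
split=> //; apply: contraTneq ltvw => ->; by rewrite -leqNgt ltnW.
Qed.

Lemma color_v_lat : k + 3 <= c [set v; lat v].
Proof. by rewrite color_ge ?f_lt_lat // -keyn key_ler lat_max. Qed.

Lemma color_vw : k + 3 <= c [set v; w].
Proof. by rewrite color_ge ?keyn. Qed.

(** The edges from [v] to [w] and to [lat v] are both outside the palette; when they coincide, only
    one vertex is set aside. *)
Lemma card_saturated_v : #|saturated v| <= 1 + (w == lat v).
Proof.
have := @card_saturated_colors _ c (nbr v) v (k + 3) [set w; lat v] (nbr_gt1 v).
rewrite cards2 -/(saturated v); case: (w == lat v) => /= sat.
  suff : #|saturated v| + 1 <= 3 by rewrite addn1 ltnS.
  by apply: sat => // y /set2P[]->; rewrite inE ?evw ?lat_nbr ?color_vw ?color_v_lat.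
suff : #|saturated v| + 2 <= 3 by rewrite addn2 !ltnS.
by apply: sat => // y /set2P[]->; rewrite inE ?evw ?lat_nbr ?color_vw ?color_v_lat.
Qed.

(* Three neighbors of [v] do not count: [w], [lat v] and the parent of [v], or
   [u] when [v = s]; and [k ^ 2 - 3 < (k + 1) * (k - 1)]. *)
Lemma card_frequent_forward : w != lat v ->
  #|[set a : 'I_(k + 3) | k.-1 <= color_count c (forward v) v a]| <= k.
Proof.
move=> wl; set F := [set a | _].
have [z [evz zw zl cz]] :
    exists z, [/\ e v z, z != w, z != lat v
                & z \notin forward v \/ k + 3 <= c [set v; z]].
  have [vs|vs] := eqVneq v s.
    exists u; rewrite vs lat_s esu ut (inv_su cI) leq_add2l; split=> //; last by right.
    by apply: contraNneq nsp => <-; rewrite vs /special eqxx orbT.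
  have ltp := f_par_lt vs; exists (par v); split=> //.
  - exact/f_vw_le/ltnW.
  - by apply: contraTneq (ltn_trans ltp (f_lt_lat vt)) => ->; rewrite ltnn.
  - by left; rewrite !inE ltnNge (ltnW ltp) andbF.
suff : #|F| * k.-1 + 3 <= k * k by move: k_gt1 (#|F|); clear; nia.
have card3 : #|[set z; w; lat v]| = 3.
  by rewrite setUC cardsU1 cards2 !inE zw negb_or eq_sym zl eq_sym wl.
rewrite -[X in _ + X <= _]card3; apply: leq_trans (nbr_le v).
apply: card_frequent_colors.
- by apply/subsetP => y; rewrite !inE => /andP[].
- by apply/subsetP => y; rewrite !inE => /orP[/orP[]|] /eqP->.
move=> y; rewrite in_setU => /orP[/set2P[]|/set1P] ->.
- by case: cz => [/negPf->|].
- by rewrite color_vw.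
- by rewrite color_v_lat.
Qed.


Let siblings : {set T} :=
  [set y | [&& f y < f v, y != s, par y == par v
             & c [set y; par y] == c [set v; par v]]].

(** [v] and its siblings are joined to [p] by one color, and all but possibly [lat p] are counted in
    [inv_forward]. Including [v] makes up for [lat p]. *)
Lemma card_siblings : v != s -> #|siblings| < k.
Proof.
move=> vs; set p := par v; have ltp := f_par_lt vs; rewrite -/p in ltp.
have epv : e p v by rewrite e_sym par_nbr.
have lta : c [set v; p] < k + 5.
  by rewrite setUC color_lt // -keyn key_ltl.
apply: leq_ltn_trans (inv_forward cI p lta).
set E := [set y in forward p | c [set p; y] == c [set v; p]].
have sub : v |: siblings \subset lat p |: E.
  apply/subsetP => y yvs; have [ys [py cy]] : y != s /\ par y = p /\
      c [set y; par y] = c [set v; p].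
    case/setU1P: yvs => [->|]; first by rewrite vs.
    by rewrite inE => /and4P[_ -> /eqP-> /eqP->].
  have ltpy := f_par_lt ys; rewrite py in ltpy cy.
  have epy : e p y by rewrite -py e_sym par_nbr.
  rewrite !inE epy ltpy [[set p; y]]setUC cy eqxx andbT /=.
  by case: (y == lat p).
have := subset_leq_card sub; rewrite !cardsU1 inE ltnn add1n => le1.
by rewrite -ltnS; apply: leq_trans le1 _; rewrite -add1n leq_add2r leq_b1.
Qed.

Lemma greedy_choice : exists c', greedy_inv n.+1 c'.
Proof.
pose rest := \sum_(z in nbr v | z != w) c [set v; z].
pose bad := if w == lat v
  then [set a : 'I_(k + 3) | [exists y in siblings, a + rest == color_sum c y]]
  else [set a : 'I_(k + 3) | k.-1 <= color_count c (forward v) v a].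
(* The sum rule excludes at most [k - 1] colors, which pays for the second saturated color at [v].
   In all at most [k + 2] of the [k + 3] colors are excluded. *)
have cardbad : #|bad| + (w == lat v) <= k.
  rewrite /bad; case: ifP => [/eqP wl|/negbT wl]; last first.
    by rewrite addn0 card_frequent_forward.
  have vs : v != s.
    by apply: contraNneq nsp => vs; rewrite wl vs lat_s /special eqxx.
  have K0 : 0 < k + 3 by rewrite addnS.
  rewrite addn1; apply: leq_ltn_trans (card_siblings vs).
  (* Each sibling [y] excludes at most the color [color_sum c y - rest]. The default of [insubd] is
     harmless: only actual colors [a] need a preimage. *)
  apply: leq_trans (leq_imset_card
    (fun y => insubd (Ordinal K0) (color_sum c y - rest)) siblings).
  apply/subset_leq_card/subsetP => a; rewrite inE => /exists_inP[y ysib /eqP eqy].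
  apply/imsetP; exists y => //; apply: val_inj.
  by rewrite val_insubd -eqy addnK ltn_ord.
have [a] : exists a, a \notin saturated v :|: saturated w :|: bad.
  apply/existsP; rewrite -negb_forall; apply/negP => /forallP all_bad.
  have : k + 3 <= #|saturated v :|: saturated w :|: bad|.
    rewrite -[leqLHS]card_ord; apply/subset_leq_card/subsetP => a _.
    exact: all_bad.
  apply/negP; rewrite -ltnNge.
  apply: leq_ltn_trans (leq_card_setU _ _) _.
  apply: leq_ltn_trans (leq_add (leq_card_setU _ _) (leqnn _)) _.
  have := card_saturated_v; have := card_saturated_w; move: cardbad.
  by move: #|bad| #|saturated v| #|saturated w|; case: (w == lat v); clear; lia.
rewrite !inE !negb_or -!leqNgt => /andP[/andP[majv majw] nbad].
exists (recolor c [set v; w] a); apply: greedy_step => //.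
- move=> wl; move: nbad; rewrite /bad (negPf wl) inE -ltnNge.
  by move: (color_count _ _ _ _) k_gt1; clear; lia.
move=> wl y lty ys pary cy eqsum; move: nbad; rewrite /bad wl eqxx inE.
case/negP; apply/exists_inP; exists y; last by rewrite /rest eqsum.
by rewrite inE lty ys -cy -pary !eqxx.
Qed.

End Step.

Lemma greedy_coloring n : exists c, greedy_inv n c.
Proof.
elim: n => [|n [c cI]]; first by eexists; apply: greedy_inv0.
have [/existsP[v /existsP[w /and4P[evw ltvw nsp /eqP keyn]]]|noedge] :=
  boolP [exists v, exists w,
           [&& e v w, f v < f w, ~~ special [set v; w] & key v w == n]].
  exact: (greedy_choice cI evw ltvw nsp keyn).
have nokey x y : e x y -> f x < f y -> ~~ special [set x; y] -> key x y != n.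
  move=> exy ltxy nsp; apply: contra noedge => kn.
  by apply/existsP; exists x; apply/existsP; exists y; rewrite exy ltxy nsp.
exists c; split; try by case: cI.
- move=> x y exy ltxy nsp; rewrite ltnS leq_eqVlt (negPf (nokey _ _ exy ltxy nsp)).
  exact: (inv_done cI).
- by move=> x y exy ltxy nsp /ltnW; apply: (inv_todo cI).
move=> x y ltyx ys xt; rewrite ltnS leq_eqVlt => /orP[kn|]; last exact: (inv_sum cI).
have xs : x != s.
  apply: contraTneq ltyx => ->; rewrite -leqNgt.
  by have [->|/f_s_lt/ltnW] := eqVneq y s.
have ltxl := f_lt_lat xt.
(* A vertex completed at [n] would have an ordinary last edge of key [n]: [s] lies on every special
   edge, but is neither [x] nor the later [lat x]. *)
have nsp : ~~ special [set x; lat x].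
  apply/negP => /special_memb /set2P[sx|sl]; first by rewrite sx eqxx in xs.
  by have := ltn_trans (f_s_lt xs) ltxl; rewrite -sl ltnn.
by have := nokey _ _ (lat_nbr x) ltxl nsp; rewrite kn.
Qed.

(** * The finished coloring *)

Section Final.

Variable c : {set T} -> nat.
Hypothesis cI : greedy_inv (M * M) c.

Let key_lt x y : key x y < M * M.
Proof. by rewrite /key; have := f_lt x; have := f_lt y; nia. Qed.

Lemma greedy_color_lt x y : e x y -> c [set x; y] < k + 5.
Proof.
case: (ltngtP (f x) (f y)) => [ltxy|ltyx|/f_inj->] exy; last by rewrite e_irr in exy.
  exact: (color_lt cI).
by rewrite setUC (color_lt cI) // e_sym.
Qed.

Lemma greedy_color_special x y : e x y -> k + 3 <= c [set x; y] ->
  [set x; y] = [set s; t] \/ [set x; y] = [set s; u].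
Proof.
wlog ltxy : x y / f x < f y => [wl exy|exy].
  case: (ltngtP (f x) (f y)) => [|ltyx|/f_inj xy]; first by move/wl; apply.
    by rewrite setUC; apply: wl; rewrite // e_sym.
  by rewrite xy e_irr in exy.
rewrite leqNgt; have [/orP[/eqP|/eqP]|nsp] := boolP (special [set x; y]);
  [by left | by right |].
by rewrite (inv_done cI).
Qed.

(** Ordinary edges have colors below [k + 3], and the two special edges have different colors. *)
Lemma greedy_color_unique x y g : e x y -> special g ->
  c [set x; y] = c g -> [set x; y] = g.
Proof.
move=> exy spg eqc.
have spc : c g = k + 3 /\ g = [set s; t] \/ c g = k + 4 /\ g = [set s; u].
  by case/orP: spg => /eqP->; rewrite ?(inv_st cI) ?(inv_su cI); [left|right].
have: k + 3 <= c [set x; y] by rewrite eqc; case: spc => -[-> _]; rewrite leq_add2l.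
move=> /(greedy_color_special exy) xyE.
case: xyE (eqc) => ->; rewrite ?(inv_st cI) ?(inv_su cI) => ck;
  by case: spc => -[cg ->] //; rewrite cg in ck; move/eqP: ck; rewrite eqn_add2l.
Qed.

Lemma greedy_distinguishing : distinguishing e c.
Proof.
move=> phi aut pres.
have fix_special x : e s x -> special [set s; x] -> [set phi s; phi x] = [set s; x].
  by move=> esx sp; apply: greedy_color_unique; rewrite ?aut ?pres.
have phist : [set phi s; phi t] = [set s; t].
  by apply: fix_special; rewrite /special ?eqxx.
have phisu : [set phi s; phi u] = [set s; u].
  by apply: fix_special; rewrite /special ?eqxx ?orbT.
(* If [phi s] were [t], then [t] would also lie on the edge [su], but it differs from [s] and
   [u]. *)
have phis : phi s = s.
  have := set21 (phi s) (phi t); rewrite phist => /set2P[//|phist'].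
  have := set21 (phi s) (phi u); rewrite phisu phist' => /set2P[] tE.
    by have := st_neq; rewrite tE eqxx.
  by have := ut; rewrite tE eqxx.
have phit : phi t = t by apply: (@set2_injr _ s); rewrite -{1}phis.
have sumE x : color_sum c (phi x) = color_sum c x.
  rewrite /color_sum (reindex_inj (@perm_inj _ phi)) /=.
  by apply: eq_big => y; rewrite !inE aut // => /pres.
(* [s] is listed apart because its parent comes after it, while it must already be fixed when it is
   the parent of other vertices. *)
suff fixed n x : x = s \/ f (par x) < n -> phi x = x.
  by apply/permP => x; rewrite perm1; apply: (fixed M); right.
elim: n x => [|n IHn] x [->//|]; rewrite // ltnS => leparx.
have [->//|xs] := eqVneq x s.
set p := par x in leparx.
have phip : phi p = p.
  apply: IHn; have [|ps] := eqVneq p s; [by left | right].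
  exact: leq_trans (f_par_lt ps) leparx.
have epx : e p x by rewrite e_sym par_nbr.
have epy : e p (phi x) by rewrite -phip aut.
have ys : phi x != s.
  by apply: contraNneq xs => phx; apply/eqP/(@perm_inj _ phi); rewrite phx.
have lepary : f (par (phi x)) <= f p by apply: par_min; rewrite e_sym.
(* If the parent of [phi x] comes earlier, [phi x] is fixed by induction, and so is [x] by
   injectivity. Otherwise both have the parent [p]. *)
have [lty|ley] := ltnP (f (par (phi x))) n.
  by apply: (@perm_inj _ phi); apply: IHn; right.
have pary : par (phi x) = p by apply: f_inj; lia.
have cy : c [set phi x; par (phi x)] = c [set x; par x].
  by rewrite pary -{1}phip pres // par_nbr.
apply/eqP/negPn/negP => yx.
(* [inv_sum] does not cover [t] as the later vertex, since [t] has no later neighbor whose edge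
   could adjust its sum; but [t] is already fixed. *)
have xt : x != t by apply: contraNneq yx => ->; rewrite phit.
have yt : phi x != t.
  by apply: contraNneq xt => phx; apply/eqP/(@perm_inj _ phi); rewrite phx.
case: (ltngtP (f x) (f (phi x))) => [lt|lt|/f_inj xE]; last by rewrite -xE eqxx in yx.
  exact: (inv_sum cI lt xs yt (key_lt _ _) pary cy (sumE x)).
exact: (inv_sum cI lt ys xt (key_lt _ _) (esym pary) (esym cy) (esym (sumE x))).
Qed.

End Final.

End GreedyColoring.

(** * From neighborhoods back to edges, and the final bound *)

Lemma card_incident (T : finType) (e : rel T) (x : T) (P : pred {set T}) :
    symmetric e ->
  #|[set g in incident e x | P g]| = #|[set y in nbr e x | P [set x; y]]|.
Proof.
move=> e_sym.
have -> : [set g in incident e x | P g] =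
    [set [set x; y] | y in [set y in nbr e x | P [set x; y]]].
  apply/setP => g; rewrite !inE; apply/idP/imsetP.
    case/andP=> /andP[/imset2P[y z _]]; rewrite inE /= => eyz ->.
    case/set2P => ->; first by exists z; rewrite // !inE eyz.
    by rewrite setUC => Pg; exists y; rewrite // !inE e_sym eyz.
  case=> y; rewrite !inE => /andP[exy Pxy] ->; rewrite Pxy set21 !andbT.
  by apply/imset2P; exists x y; rewrite // inE.
by rewrite card_imset // => y z; apply: set2_injr.
Qed.

Lemma degree_card_nbr (T : finType) (e : rel T) (x : T) :
  symmetric e -> degree e x = #|nbr e x|.
Proof.
move=> e_sym; have := card_incident x predT e_sym.
have -> : [set g in incident e x | predT g] = incident e x.
  by apply/setP => g; rewrite [LHS]inE andbT.
suff -> : [set y in nbr e x | predT [set x; y]] = nbr e x by [].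
by apply/setP => y; rewrite [LHS]inE andbT.
Qed.

Lemma majority_distinguishing_colorable_sqrt (T : finType) (e : rel T) (k : nat) :
    symmetric e -> irreflexive e -> k_connected e 2 -> max_degree e <= k * k ->
  majority_distinguishing_colorable e (k + 5).
Proof.
move=> e_sym e_irr conn2 le_max.
have [ltT _] := conn2.
have nbrE x : exists t u, [/\ e x t, e x u & u != t].
  have [z xz] : exists z, x != z.
    apply/existsP; rewrite -negb_forall; apply/negP => /forallP allx.
    have : #|T| <= #|[set x]|.
      by apply/subset_leq_card/subsetP => y _; rewrite inE eq_sym allx.
    by rewrite cards1; move: ltT; case: #|T| => [|[]].
  have [t ext tz] := neighbor_avoiding conn2 xz.
  have [|u exu ut] := @neighbor_avoiding _ _ conn2 x t; last by exists t, u.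
  by apply: contraTneq ext => <-; rewrite e_irr.
have nbr_gt1 x : 1 < #|nbr e x|.
  have [t [u [ext exu ut]]] := nbrE x; have := cards2 u t; rewrite ut => <-.
  by apply/subset_leq_card/subsetP => y /set2P[]->; rewrite inE.
have nbr_le x : #|nbr e x| <= k * k.
  by rewrite -degree_card_nbr //; apply: leq_trans le_max; apply: leq_bigmax.
have [s _] : exists s : T, s \in T by apply/card_gt0P; apply: leq_trans ltT.
have k_gt1 : 1 < k.
  by have := leq_trans (nbr_gt1 s) (nbr_le s); case: k {le_max nbr_le} => [|[]].
have [t [u [est esu ut]]] := nbrE s.
have [f [f_inj' _ _ low up]] := st_order_exists e_sym e_irr conn2 est.
have f_inj : injective f by move=> x y; apply: f_inj'; rewrite inE.
have f_low x : x != s -> exists2 y, e x y & f y < f x.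
  by case/low; rewrite ?inE // => y []; exists y.
have f_up x : x != t -> exists2 y, e x y & f x < f y.
  by case/up; rewrite ?inE // => y []; exists y.
have [lat lat_nbr lat_max] : exists2 lat : T -> T, forall x, e x (lat x)
    & forall x y, e x y -> f y <= f (lat x).
  have /fin_all_exists[lat latP] x : exists y, e x y /\ forall z, e x z -> f z <= f y.
    have [y0 [_ [ex0 _ _]]] := nbrE x.
    by exists [arg max_(y > y0 | e x y) f y]; case: arg_maxnP.
  by exists lat => x; case: (latP x).
have [par par_nbr par_min] : exists2 par : T -> T, forall x, e x (par x)
    & forall x y, e x y -> f (par x) <= f y.
  have /fin_all_exists[par parP] x : exists y, e x y /\ forall z, e x z -> f y <= f z.
    have [y0 [_ [ex0 _ _]]] := nbrE x.
    by exists [arg min_(y < y0 | e x y) f y]; case: arg_minnP.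
  by exists par => x; case: (parP x).
pose M := (\max_x f x).+1.
have f_lt x : f x < M by rewrite ltnS leq_bigmax.
have [c cI] := greedy_coloring e_sym f_inj f_lt f_low f_up est esu ut k_gt1 nbr_le
  nbr_gt1 lat_nbr lat_max par_nbr par_min (M * M).
have color_ltk := greedy_color_lt e_sym e_irr f_inj f_lt est esu ut k_gt1 cI.
exists c; split.
- by move=> g /imset2P[x y _]; rewrite inE => /andP[_ exy] ->; apply: color_ltk.
- move=> x a; rewrite card_incident // -/(degree e x) degree_card_nbr //.
  have [lta|lea] := ltnP a (k + 5); first exact: (inv_majority cI).
  (* [majority] ranges over all numbers; those from [k + 5] on do not occur as colors. *)
  rewrite (_ : [set y in _ | _] = set0) ?cards0 //.
  apply/setP => y; rewrite !inE; apply/negP => /andP[exy /eqP ca].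
  by have := color_ltk _ _ exy; rewrite ca ltnNge lea.
- exact: (greedy_distinguishing e_sym e_irr f_inj f_lt f_low est esu ut k_gt1
           par_nbr par_min cI).
Qed.

Local Open Scope ring_scope.

Theorem theorem18 (R : realType) (T : finType) (e : rel T)
    (e_sym : symmetric e) (e_irr : irreflexive e) (e_2conn : k_connected e 2) :
  exists m : nat,
    is_majority_distinguishing_index e m /\
    m%:Z <= Num.ceil (Num.sqrt ((max_degree e)%:R : R)) + 5.
Proof.
set r := Num.sqrt _; set k := `|Num.ceil r|%N.
(* The ceiling is nonnegative because the root exceeds -1, so the absolute value changes nothing. *)
have kE : k%:Z = Num.ceil r 
  by rewrite gez0_abs // ceil_ge0 (lt_le_trans (ltrN10 _)) ?sqrtr_ge0.
have le_max : (max_degree e <= k * k)%N.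
  rewrite -(ler_nat R) natrM -expr2 -[leLHS]sqr_sqrtr ?ler0n //.
  rewrite lerXn2r ?nnegrE ?sqrtr_ge0 ?ler0n //.
  have := ceil_ge r; rewrite -kE; exact.
(* Colorability is made boolean classically, so that [ex_minnP] yields the least number of
   colors. *)
have ex : exists m, `[< majority_distinguishing_colorable e m >].
  by exists (k + 5)%N; apply/asboolP/majority_distinguishing_colorable_sqrt.
case: (ex_minnP ex) => m /asboolP colm minm; exists m; split.
  by split=> // j colj; apply: minm; apply/asboolP.
rewrite -kE -[5]/(5%:Z) -PoszD lez_nat; apply: minm.
exact/asboolP/majority_distinguishing_colorable_sqrt.
Qed.
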